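(* Let $Q$ be a poset, $M$ a $Q$-module, and let $\Upsilon$ be the set of constant upsets from a constant subdivision of $Q$ subordinate to $M$. Then the partition of $Q$ into uptight regions for $\Upsilon$ forms another constant subdivision of $Q$ subordinate to $M$.
   Context: Fix a field $k$. A module over a poset $(Q,\preceq)$ (a $Q$-module) is a $Q$-graded $k$-vector space $M=\bigoplus_{q\in Q}M_q$ with linear maps $M_q\to M_{q'}$ for $q\preceq q'$ (with $M_q\to M_q$ the identity) such that $M_q\to M_{q''}$ equals $M_q\to M_{q'}\to M_{q''}$ whenever $q\preceq q'\preceq q''$. A *constant subdivision* of $Q$ *subordinate* to $M$ is a partition of $Q$ into *constant regions* such that for each region $I$ there is a single vector space $M_I$ with an isomorphism $M_I\to M_i$ for every $i\in I$, having no monodromy: if $I,J$ are constant regions (possibly equal), then all pairs $i\preceq j$ with $i\in I$, $j\in J$ induce the same composite $M_I\to M_i\to M_j\to M_J$ (last map the inverse of the given isomorphism). Given such a subdivision, a *constant upset* is either the upset $U_I$ generated by a constant region $I$ (all elements above some element of $I$), or the complement of the downset $D_I$ cogenerated by a constant region $I$ (all elements below some element of $I$). For a set $\Upsilon$ of upsets, two elements $a,b\in Q$ lie in the same *uptight region* if they are contained in exactly the same members of $\Upsilon$. *)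

(* Defs.v *)
From mathcomp Require Export all_boot all_order all_algebra.
From mathcomp Require Export boolp classical_sets.

Set Implicit Arguments.
Unset Strict Implicit.
Unset Printing Implicit Defensive.

Import Order.TTheory GRing.Theory.

Local Open Scope order_scope.
Local Open Scope classical_set_scope.

(* The graded vector space is given by the family of its components. *)
Record posetModule (k : fieldType) (d : Order.disp_t) (Q : porderType d) :=
  PosetModule {
    pm_space :> Q -> lmodType k;
    pm_map : forall p q : Q, p <= q -> {linear pm_space p -> pm_space q};
    pm_map_id : forall (q : Q) (qq : q <= q) (x : pm_space q),
      pm_map qq x = x;
    pm_map_comp : forall (p q r : Q) (pq : p <= q) (qr : q <= r) (pr : p <= r)
      (x : pm_space p),
      pm_map pr x = pm_map qr (pm_map pq x)
  }.

Arguments pm_map {k d Q} _ {p q} _.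

Section ConstantSubdivision.

Context (k : fieldType) (d : Order.disp_t) (Q : porderType d).

(* [phi I i] is the isomorphism M_I -> M_i and [psi I i] its inverse. The
   families [V], [phi] and [psi] are indexed by all subsets and all elements,
   but are constrained, and used, only for I in R and i in I. *)
Definition constant_subdivision (M : posetModule k Q) (R : set (set Q)) : Prop :=
  partition R id [set: Q] /\
  exists (V : set Q -> lmodType k)
         (phi : forall (I : set Q) (i : Q), {linear V I -> M i})
         (psi : forall (I : set Q) (i : Q), {linear M i -> V I}),
    (forall (I : set Q) (i : Q), R I -> I i ->
       cancel (phi I i) (psi I i) /\ cancel (psi I i) (phi I i)) /\
    (forall I J : set Q, R I -> R J ->
       forall (i j : Q) (ij : i <= j) (i' j' : Q) (ij' : i' <= j'),
         I i -> J j -> I i' -> J j' ->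
         psi J j \o pm_map M ij \o phi I i
           =1 psi J j' \o pm_map M ij' \o phi I i').

Definition upset_gen (A : set Q) : set Q := [set q | exists2 a, A a & a <= q].

Definition constant_upsets (R : set (set Q)) : set (set Q) :=
  [set U | exists2 I, R I & U = upset_gen I \/ U = ~` down I].

Definition uptight_regions (Upsilon : set (set Q)) : set (set Q) :=
  [set A | exists a : Q,
     A = [set b | forall U : set Q, Upsilon U -> (U a <-> U b)]].

End ConstantSubdivision.

(* Main.v *)
Require Import Defs.

Set Implicit Arguments.
Unset Strict Implicit.
Unset Printing Implicit Defensive.

Import Order.TTheory.

Local Open Scope order_scope.
Local Open Scope classical_set_scope.

(** Call two elements uptight when they lie in the same constant upsets. If
    [a] is uptight with an element of a constant region [I], then [a] lies in
    the upset generated by [I] and in the downset cogenerated by [I], so it is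
    sandwiched, [x <= a <= y] with [x] and [y] in [I]. This suggests taking for
    the vector space of an uptight region [A] the space [M_I], where [I] is any
    constant region meeting [A], and comparing it with [M_a] along
    [M_I -> M_x -> M_a] in one direction and [M_a -> M_y -> M_I] in the other.

    Composing the comparison maps around any [a <= b], with [a] in [A] and [b]
    in [B], gives a composite [M_I -> M_x -> M_y -> M_J] with [x] in [I] and
    [y] in [J]. This transition from [M_I] to [M_J] depends only on [I] and [J]
    because the original subdivision has no monodromy. So monodromy cannot occur
    among uptight regions either, and for [a = b] the composite is the identity
    of [M_I] ([transition_id]). What remains is the injectivity of [M_a -> M_I]
    ([to_region_inj]): the relation uptight is symmetric, so the elements of
    [A] in [I] are in turn sandwiched between elements of the constant region
    [K] containing [a]. This gives a transition [M_I -> M_K], which is a left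
    inverse of [M_a -> M_I] once [M_a] is identified with [M_K]. *)

Section UptightRegions.

Context (d : Order.disp_t) (Q : porderType d).
Implicit Types (Upsilon R : set (set Q)) (A I : set Q) (a b : Q).

Definition uptight Upsilon a b : Prop :=
  forall U, Upsilon U -> (U a <-> U b).

Lemma uptight_sym Upsilon a b : uptight Upsilon a b -> uptight Upsilon b a.
Proof. by move=> ab U UU; have [] := ab U UU; split. Qed.

Lemma uptight_trans Upsilon b a c :
  uptight Upsilon a b -> uptight Upsilon b c -> uptight Upsilon a c.
Proof.
by move=> ab bc U UU; split=> [/(ab _ UU)/(bc _ UU)|/(bc _ UU)/(ab _ UU)].
Qed.

Lemma uptight_in_region Upsilon A a b :
  uptight_regions Upsilon A -> A a -> A b -> uptight Upsilon a b.
Proof. by move=> [c ->] ca; apply: uptight_trans; exact: uptight_sym ca. Qed.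

Lemma uptight_regions_partition Upsilon :
  partition (uptight_regions Upsilon) id [set: Q].
Proof.
split.
- apply/seteqP; split=> // a _.
  by exists [set b | uptight Upsilon a b]; [exists a | ].
- move=> A B [a ->] [b ->] [c [ac bc]].
  apply/seteqP; split=> e; apply: uptight_trans.
    exact: uptight_trans bc (uptight_sym ac).
  exact: uptight_trans ac (uptight_sym bc).
- by move=> A [a ->]; exists a.
Qed.

(** Membership of [a0] in the upset generated by [I] provides the lower bound,
    and its non-membership in the complement of the downset of [I] the upper
    one. *)
Lemma uptight_sandwich R I a0 a :
  R I -> I a0 -> uptight (constant_upsets R) a0 a ->
  exists x y, [/\ I x, I y, x <= a & a <= y].
Proof.
move=> RI Ia0 a0a.
have [x Ix xa] : upset_gen I a.
  by apply/(a0a (upset_gen I)); [exists I => //; left | exists a0].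
have [y [Iy ay]] : down I a.
  apply: contrapT => /(a0a (~` down I)); apply; first by exists I => //; right.
  by exists a0.
by exists x, y.
Qed.

End UptightRegions.

Section Transition.

Context (k : fieldType) (d : Order.disp_t) (Q : porderType d).
Context (M : posetModule k Q) (R : set (set Q)) (V : set Q -> lmodType k).
Context (phi : forall (I : set Q) (i : Q), {linear V I -> M i}).
Context (psi : forall (I : set Q) (i : Q), {linear M i -> V I}).
Context (isoR : forall (I : set Q) (i : Q), R I -> I i ->
  cancel (phi I i) (psi I i) /\ cancel (psi I i) (phi I i)).
Context (no_monodromy : forall I J : set Q, R I -> R J ->
  forall (i j : Q) (ij : i <= j) (i' j' : Q) (ij' : i' <= j'),
    I i -> J j -> I i' -> J j' ->
    psi J j \o pm_map M ij \o phi I i =1 psi J j' \o pm_map M ij' \o phi I i').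
Implicit Types (I J : set Q).

(** By the absence of monodromy, the pair [i <= j] may be replaced by
    [i <= i]. *)
Lemma transition_id I i j (ij : i <= j) : R I -> I i -> I j ->
  cancel (phi I i) (psi I j \o pm_map M ij).
Proof.
move=> RI Ii Ij v.
have /= -> := no_monodromy RI RI ij (lexx i) Ii Ij Ii Ii v.
by rewrite pm_map_id (isoR RI Ii).1.
Qed.

(** With [J] the constant region of [a], the map is, up to the isomorphism
    [M_J -> M_a], the transition [M_J -> M_I]. This can be computed on any pair
    [j <= a0], and is then undone by the transition along any [a0 <= j'] with
    [j'] in [J]. *)
Lemma to_region_inj I J a0 a y (ay : a <= y) :
  R I -> R J -> I a0 -> J a -> I y -> uptight (constant_upsets R) a a0 ->
  injective (psi I y \o pm_map M ay).
Proof.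
move=> RI RJ Ia0 Ja Iy aa0.
have [j [j' [Jj Jj' ja0 a0j']]] := uptight_sandwich RJ Ja aa0.
apply: (can_inj (g := phi J a \o psi J j' \o pm_map M a0j' \o phi I a0)) => m.
rewrite -[m in LHS](isoR RJ Ja).2 /=.
have /= -> := no_monodromy RJ RI ay ja0 Ja Iy Jj Ia0 (psi J a m).
rewrite (isoR RI Ia0).2 -(pm_map_comp _ _ (le_trans ja0 a0j')).
have /= -> := transition_id (le_trans ja0 a0j') RJ Jj Jj' (psi J a m).
exact: (isoR RJ Ja).2.
Qed.

End Transition.

Theorem theorem4p19 (k : fieldType) (d : Order.disp_t) (Q : porderType d)
    (M : posetModule k Q) (R : set (set Q)) :
  constant_subdivision M R ->
  constant_subdivision M (uptight_regions (constant_upsets R)).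
Proof.
move=> [[coverR _ _] [V [phi [psi [isoR no_monodromy]]]]].
have region a : exists2 I, R I & I a.
  have [I RI Ia] : cover R id a by rewrite coverR.
  by exists I.
split; first exact: uptight_regions_partition.
set UR := uptight_regions _.
(* The constant region whose vector space the uptight region [A] inherits. *)
have /choice[rep repP] A : exists I, UR A -> R I /\ exists2 a0, I a0 & A a0.
  have [[a Aa]|A0] := pselect (A !=set0).
    by have [I RI Ia] := region a; exists I; split=> //; exists a.
  by exists set0 => -[a Aa]; case: A0; exists a; rewrite Aa.
(* [fg] pairs the comparison isomorphism with its inverse. Outside uptight
   regions, where nothing is asked, the given maps serve as dummy values. *)
have comparison_ex A a :
    exists fg : {linear V (rep A) -> M a} * {linear M a -> V (rep A)},
    UR A -> A a -> exists x y (xa : x <= a) (ay : a <= y),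
      [/\ rep A x, rep A y, fg.1 =1 pm_map M xa \o phi (rep A) x
        & fg.2 =1 psi (rep A) y \o pm_map M ay].
  have [[URA Aa]|nA] := pselect (UR A /\ A a); last first.
    by exists (phi (rep A) a, psi (rep A) a) => URA Aa; case: nA.
  have [RI [a0 Ia0 Aa0]] := repP A URA.
  have [x [y [Ix Iy xa ay]]] :=
    uptight_sandwich RI Ia0 (uptight_in_region URA Aa0 Aa).
  exists (pm_map M xa \o phi (rep A) x : {linear _ -> _},
          psi (rep A) y \o pm_map M ay : {linear _ -> _}) => _ _.
  by exists x, y, xa, ay.
have comparison A a := cid (comparison_ex A a).
exists (V \o rep), (fun A a => (sval (comparison A a)).1),
  (fun A a => (sval (comparison A a)).2); split.
- move=> A a URA Aa.
  case: (comparison A a) => -[f g] /= /(_ URA Aa)[x [y [xa [ay [Ix Iy fE gE]]]]].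
  have [RI [a0 Ia0 Aa0]] := repP A URA.
  have [J RJ Ja] := region a.
  have fK : cancel f g.
    move=> v; rewrite fE gE /= -(pm_map_comp _ _ (le_trans xa ay)).
    exact: (transition_id isoR no_monodromy).
  split=> // m.
  (* As [g] is injective, its right inverse [f] is also a left inverse. *)
  apply: (to_region_inj isoR no_monodromy (ay := ay) RI RJ Ia0 Ja Iy).
    exact: uptight_in_region URA Aa Aa0.
  by rewrite -!gE fK.
- move=> A B URA URB a b ab a' b' ab' Aa Bb Aa' Bb' v /=.
  have [RI _] := repP A URA; have [RJ _] := repP B URB.
  have transitionE c e (ce : c <= e) : A c -> B e ->
      exists x y (xy : x <= y), [/\ rep A x, rep B y &
        (sval (comparison B e)).2 (pm_map M ce ((sval (comparison A c)).1 v))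
        = psi (rep B) y (pm_map M xy (phi (rep A) x v))].
    move=> Ac Be.
    case: (comparison A c) => -[f ?] /= /(_ URA Ac)[x [_ [xc [_ [Ix _ fE _]]]]].
    case: (comparison B e) => -[? g] /= /(_ URB Be)[_ [y [_ [ey [_ Jy _ gE]]]]].
    exists x, y, (le_trans xc (le_trans ce ey)); split=> //.
    rewrite fE gE /= -(pm_map_comp _ _ (le_trans ce ey)).
    by rewrite -(pm_map_comp _ _ (le_trans xc (le_trans ce ey))).
  have [x [y [xy [Ix Jy ->]]]] := transitionE a b ab Aa Bb.
  have [x' [y' [xy' [Ix' Jy' ->]]]] := transitionE a' b' ab' Aa' Bb'.
  exact: no_monodromy.
Qed.
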